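(* Let $n,h\geq 0$ be integers, and let $H_n^{(h)}$ be the number of edges of the Hasse diagram of the poset of independent sets of $\mathbf{P}_n^{(h)}$ ordered by inclusion. Then \[ H_n^{(h)}=\sum_{i=1}^{n} F_i^{(h)}F_{n-i+1}^{(h)}, \] where the empty sum (for $n=0$) equals $0$.
   Context: For $n,h\geq 0$, the $h$-power of a path $\mathbf{P}_n^{(h)}$ is the graph with vertices $v_1,\dots,v_n$ in which, for $i\neq j$, $v_i$ and $v_j$ are adjacent if and only if $|j-i|\leq h$. An independent set of a graph is a subset of its vertex set containing no two adjacent vertices. The $h$-Fibonacci sequence $(F_n^{(h)})_{n\geq 1}$ is defined by $F_n^{(h)}=1$ for $1\leq n\leq h+1$ and $F_n^{(h)}=F_{n-1}^{(h)}+F_{n-h-1}^{(h)}$ for $n>h+1$. *)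

(* Defs.v *)
From HB Require Import structures.
From mathcomp Require Import all_boot all_order all_algebra.
Set Implicit Arguments.
Unset Strict Implicit.
Unset Printing Implicit Defensive.
Import Order.TTheory.

(* [path_pow h n] is the adjacency relation of P_n^(h); the vertex v_{i+1} is *)
(* the ordinal i : 'I_n. In %N, [`|i - j|] subtracts in int (no truncation).   *)
Definition path_pow (h n : nat) : rel 'I_n :=
  fun i j => (i != j) && (`|i - j| <= h)%N.

Definition independent (T : finType) (e : rel T) (S : {set T}) : bool :=
  [forall x in S, forall y in S, ~~ e x y].

Definition indep_set (T : finType) (e : rel T) : Type :=
  {S : {set T} | independent e S}.

Section IndepSetOrder.
Variables (T : finType) (e : rel T).

HB.instance Definition _ := Finite.on (indep_set e).

Definition indep_le (A B : indep_set e) : bool := sval A \subset sval B.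

Lemma indep_le_refl : reflexive indep_le.
Proof. by move=> A; apply: subxx. Qed.

Lemma indep_le_anti : antisymmetric indep_le.
Proof. by move=> A B /andP[AB BA]; apply/val_inj/eqP; rewrite eqEsubset; apply/andP. Qed.

Lemma indep_le_trans : transitive indep_le.
Proof. by move=> B A C; apply: subset_trans. Qed.

HB.instance Definition _ := Order.Le_isPOrder.Build (Order.Disp tt tt)
  (indep_set e) indep_le_refl indep_le_anti indep_le_trans.

Lemma le_indepE (A B : indep_set e) : (A <= B)%O = (sval A \subset sval B).
Proof. by []. Qed.

Lemma lt_indepE (A B : indep_set e) : (A < B)%O = (sval A \proper sval B).
Proof. by rewrite lt_leAnge !le_indepE properE. Qed.

End IndepSetOrder.

Definition covered_by (d : Order.disp_t) (P : finPOrderType d) : rel P :=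
  fun x y => (x < y)%O && ~~ [exists z : P, (x < z < y)%O].

(* An edge of the Hasse diagram is recorded as the pair (lower end, upper end). *)
Definition hasse_edges (d : Order.disp_t) (P : finPOrderType d) : {set P * P} :=
  [set p | covered_by p.1 p.2].

Definition hasse_path_pow (h n : nat) : nat :=
  #|hasse_edges (indep_set (@path_pow h n))|.

(* The recursion on F_n^(h) is not structural, so [k] bounds its depth;       *)
(* [hfib_small] and [hfib_step] are the defining equations of F_n^(h), n >= 1. *)
(* The index 0 is outside the sequence; [hfib h 0] has a junk value.          *)
Fixpoint hfib_fuel (k h n : nat) : nat :=
  if k is k'.+1 then
    if n <= h.+1 then 1
    else hfib_fuel k' h (n - 1) + hfib_fuel k' h (n - h - 1)
  else 0.

Definition hfib (h n : nat) : nat := hfib_fuel n h n.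

Lemma hfib_fuelE k h n : 0 < n <= k -> hfib_fuel k h n = hfib h n.
Proof.
rewrite /hfib; elim/ltn_ind: n k => -[//|n] IHn [//|k] /andP[_ le_nk] /=.
case: ifPn => //; rewrite -ltnNge ltnS => lt_hn.
have n_gt0 : 0 < n := leq_ltn_trans (leq0n h) lt_hn.
have -> : n.+1 - h - 1 = n - h by rewrite subSn ?subn1 // ltnW.
have d_gt0 : 0 < n - h by rewrite subn_gt0.
rewrite subn1 /= !(IHn (n - h)) ?d_gt0 ?ltnS ?leq_subr //=.
  by rewrite (IHn n) // n_gt0.
exact: leq_trans (leq_subr h n) le_nk.
Qed.

Lemma hfib_small h n : 1 <= n <= h.+1 -> hfib h n = 1.
Proof. by case: n => // n /andP[_ le_nh]; rewrite /hfib /= le_nh. Qed.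

Lemma hfib_step h n :
  n > h.+1 -> hfib h n = hfib h (n - 1) + hfib h (n - h - 1).
Proof.
case: n => // n lt_hn; rewrite {1}/hfib /= leqNgt lt_hn /= subn1 /=.
have n_gt0 : 0 < n := leq_ltn_trans (leq0n h) lt_hn.
have -> : n.+1 - h - 1 = n - h by rewrite subSn ?subn1 // ltnW.
by rewrite !hfib_fuelE ?leq_subr ?subn_gt0 ?n_gt0 ?andbT /=.
Qed.

(* Main.v *)
(** If [B] covers [A], then [A] is [B] with one vertex removed, because subsets
    of independent sets are independent.  The Hasse edges are thus the pairs
    [(x, B)] with [x \in B], and they can be counted vertex by vertex.  An
    independent set of [P_n^(h)] through [v_i] is [v_i] together with independent
    sets of the paths [v_1 .. v_(i-h-1)] and [v_(i+h+1) .. v_n], chosen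
    independently; there are [F_i] and [F_(n-i+1)] of them. *)

Require Import Defs.
From mathcomp Require Import all_boot all_order all_algebra.
From mathcomp Require Import zify.

Set Implicit Arguments.
Unset Strict Implicit.
Unset Printing Implicit Defensive.

Section IndependentSets.
Variables (T : finType) (e : rel T).
Implicit Types (A B S : {set T}) (x y : T).

Definition indep_in A : {set {set T}} := [set S | independent e S & S \subset A].

Lemma independentP S :
  reflect {in S &, forall x y, ~~ e x y} (independent e S).
Proof.
apply: (iffP idP) => [/forall_inP indS x y xS yS | indS].
  exact: (forall_inP (indS x xS)).
by apply/forall_inP => x xS; apply/forall_inP => y yS; apply: indS.
Qed.

Lemma independentS A B : A \subset B -> independent e B -> independent e A.
Proof.
move=> /subsetP sAB /independentP indB; apply/independentP => x y xA yA.
by apply: indB; apply: sAB.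
Qed.

Lemma card_indep_in0 : #|indep_in set0| = 1.
Proof.
suff -> : indep_in set0 = [set set0] by rewrite cards1.
apply/setP=> S; rewrite !inE subset0 andbC; case: eqP => //= ->.
by apply/independentP => x y; rewrite inE.
Qed.

Lemma covered_by_indepP (A B : indep_set e) :
  reflect (exists2 x, x \in sval B & sval A = sval B :\ x) (covered_by A B).
Proof.
rewrite /covered_by; apply: (iffP andP) => [[]|[x xB defA]].
  rewrite lt_indepE => /properP[sAB [x xB xNA]] /existsPn noC; exists x => //.
  (* Any [x] in [B] outside [A] will do: [B :\ x] is an element of the poset that contains [A] and
     lies strictly below [B], so it must equal [A]. *)
  have indC := independentS (subD1set (sval B) x) (svalP B).
  have := noC (Sub (sval B :\ x) indC : indep_set e).
  rewrite !lt_indepE SubK properD1 // properEneq subsetD1 sAB xNA !andbT.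
  by rewrite negbK => /eqP.
split; first by rewrite lt_indepE defA properD1.
(* No cardinality fits strictly between those of [B :\ x] and [B]. *)
apply/existsPn => C; rewrite !lt_indepE; apply/negP => /andP[/proper_card ltAC].
move=> /proper_card; move: ltAC; rewrite defA (cardsD1 x (sval B)) xB.
by rewrite add1n ltnS => ltAC /(leq_trans ltAC); rewrite ltnn.
Qed.

(** Edges and pointed independent sets are compared inside pairs of plain sets: [f] forgets the
    independence proofs, [g] sends [(x, B)] to the edge below [B] obtained by deleting [x], and both
    are injective with the same image. *)
Lemma card_hasse_edges_indep :
  #|hasse_edges (indep_set e)| = \sum_x #|[set S in indep_in setT | x \in S]|.
Proof.
pose D := [set p : T * {set T} | (p.2 \in indep_in setT) && (p.1 \in p.2)].
pose f (p : indep_set e * indep_set e) : {set T} * {set T} :=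
  (sval p.1, sval p.2).
pose g (p : T * {set T}) : {set T} * {set T} := (p.2 :\ p.1, p.2).
have f_inj : injective f by move=> [A B] [A' B'] [/val_inj -> /val_inj ->].
have g_inj : {in D &, injective g}.
  move=> [x B] [y C]; rewrite !inE /= => /andP[_ xB] _ [].
  (* Test the equality of [B :\ x] and [B :\ y] at [x]: as [x] is in [B], it can only be missing on
     the right if it is [y]. *)
  move=> /[swap] <- /setP/(_ x); rewrite !inE eqxx /= xB andbT.
  by move/esym/negbFE/eqP => ->.
rewrite -(card_imset _ f_inj).
have -> : f @: hasse_edges (indep_set e) = g @: D.
  apply/setP => -[A B]; apply/imsetP/imsetP => -[].
    move=> [A' B']; rewrite inE => /covered_by_indepP/= [x xB defA] [-> ->].
    exists (x, sval B'); last by rewrite /g defA.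
    by rewrite !inE /= subsetT xB andbT (svalP B').
  move=> [x C]; rewrite !inE /= => /andP[/andP[indC _] xC] [-> ->].
  have indCx := independentS (subD1set C x) indC.
  exists (Sub (C :\ x) indCx : indep_set e, Sub C indC : indep_set e) => //.
  by rewrite inE; apply/covered_by_indepP; exists x.
rewrite card_in_imset // -sum1_card.
under [RHS]eq_bigr do rewrite -sum1_card.
rewrite pair_big_dep; apply: eq_bigl => -[x B].
by rewrite !inE.
Qed.

(** The bijection is union, inverted by taking traces on [A] and [B]. Here [e] is an arbitrary
    relation, so edges across are excluded in both directions. *)
Lemma card_indep_inU A B :
    [disjoint A & B] -> {in A & B, forall x y, ~~ e x y && ~~ e y x} ->
  #|indep_in (A :|: B)| = #|indep_in A| * #|indep_in B|.
Proof.
move=> dAB nAB; rewrite -cardsX.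
pose f (p : {set T} * {set T}) := p.1 :|: p.2.
have fA (S U : {set T}) : S \subset A -> U \subset B -> (S :|: U) :&: A = S.
  move=> sSA sUB; rewrite setIUl (setIidPl sSA).
  suff -> : U :&: A = set0 by rewrite setU0.
  by apply/disjoint_setI0; rewrite disjoint_sym; apply: disjointWr dAB.
have fB (S U : {set T}) : S \subset A -> U \subset B -> (S :|: U) :&: B = U.
  move=> sSA sUB; rewrite setIUl (setIidPl sUB).
  suff -> : S :&: B = set0 by rewrite set0U.
  by apply/disjoint_setI0; apply: disjointWl dAB.
have f_inj : {in setX (indep_in A) (indep_in B) &, injective f}.
  move=> [S U] [S' U']; rewrite !inE /= => /andP[/andP[_ SA] /andP[_ UB]].
  move=> /andP[/andP[_ SA'] /andP[_ UB']]; rewrite /f /= => eqf.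
  by rewrite -(fA _ _ SA UB) -{2}(fB _ _ SA UB) eqf fA ?fB.
rewrite -(card_in_imset f_inj); apply: eq_card => S; apply/idP/imsetP.
  rewrite inE => /andP[indS sSAB]; exists (S :&: A, S :&: B).
    by rewrite !inE !subsetIr !(independentS _ indS) ?subsetIl.
  by rewrite /f -setIUr (setIidPl sSAB).
case=> -[U V]; rewrite !inE /= => /andP[/andP[indU sUA] /andP[indV sVB]] ->.
rewrite /f /= setUSS // andbT.
move/subsetP: sUA => sUA; move/subsetP: sVB => sVB.
apply/independentP => x y; rewrite !inE => /orP[xU|xV] /orP[yU|yV].
- exact: (independentP _ indU).
- by case/andP: (nAB x y (sUA _ xU) (sVB _ yV)).
- by case/andP: (nAB y x (sUA _ yU) (sVB _ xV)).
- exact: (independentP _ indV).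
Qed.

Hypotheses (e_sym : symmetric e) (e_irr : irreflexive e).

Lemma card_indep_in_mem A x :
    x \in A ->
  #|[set S in indep_in A | x \in S]| = #|indep_in [set y in A :\ x | ~~ e x y]|.
Proof.
move=> xA; pose f S := x |: S.
have xNS S : S \in indep_in [set y in A :\ x | ~~ e x y] -> x \notin S.
  by rewrite inE => /andP[_ /subsetP sSA]; apply/negP => /sSA; rewrite !inE eqxx.
rewrite -[RHS](@card_in_imset _ _ f); last first.
  move=> S S' /xNS xS /xNS xS' eqS.
  by rewrite -(setU1K xS) -(setU1K xS') -/(f S) eqS.
apply: eq_card => S; apply/idP/imsetP.
  rewrite !inE => /andP[/andP[indS /subsetP sSA] xS]; exists (S :\ x).
    rewrite inE (independentS (subD1set S x) indS); apply/subsetP => y.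
    rewrite !inE => /andP[-> yS]; rewrite sSA //=.
    exact: (independentP _ indS).
  by rewrite /f setD1K.
case=> U; rewrite [U \in _]inE => /andP[indU /subsetP sU] ->.
rewrite !inE eqxx andbT; apply/andP; split; last first.
  by apply/subsetP => y /setU1P[-> //|/sU]; rewrite !inE => /andP[/andP[]].
have nxU y : y \in U -> ~~ e x y by move/sU; rewrite !inE => /andP[].
apply/independentP => y z /setU1P[->|yU] /setU1P[->|zU].
- by rewrite e_irr.
- exact: nxU.
- by rewrite e_sym; apply: nxU.
- exact: (independentP _ indU).
Qed.

Lemma card_indep_in_rec A x :
    x \in A ->
  #|indep_in A| =
    #|indep_in (A :\ x)| + #|indep_in [set y in A :\ x | ~~ e x y]|.
Proof.
move=> xA; rewrite -card_indep_in_mem // addnC.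
rewrite -(cardsID [set S : {set T} | x \in S] (indep_in A)); congr (_ + _).
  by apply: eq_card => S; rewrite !inE.
by apply: eq_card => S; rewrite !inE subsetD1 andbC andbA.
Qed.

End IndependentSets.

Section PathPower.
Variables h n : nat.

Let e := @path_pow h n.

Lemma path_pow_sym : symmetric e.
Proof. by move=> i j; rewrite /e /path_pow eq_sym distnC. Qed.

Lemma path_pow_irr : irreflexive e.
Proof. by move=> i; rewrite /e /path_pow eqxx. Qed.

Definition ord_itv (a b : nat) : {set 'I_n} := [set i : 'I_n | a <= i < b].

(** Induction on the right end: splitting on the last vertex [b.-1] leaves intervals shorter by 1
    and by [h.+1], which is the recursion of [hfib]. The shift by [h.+1] gives the empty interval
    the value 1. *)
Lemma card_indep_in_itv a b :
  b <= n -> #|indep_in e (ord_itv a b)| = hfib h (b - a + h.+1).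
Proof.
elim/ltn_ind: b => b IHb leb; have [leba|ltab] := leqP b a.
  have -> : ord_itv a b = set0 by apply/setP => i; rewrite !inE; lia.
  by rewrite card_indep_in0 hfib_small //; lia.
have ltb : b.-1 < n by lia.
pose x := Ordinal ltb.
rewrite (@card_indep_in_rec _ e path_pow_sym path_pow_irr _ x); last first.
  by rewrite inE /=; lia.
have -> : [set y in ord_itv a b :\ x | ~~ e x y] = ord_itv a (b.-1 - h).
  by apply/setP => y; rewrite !inE /e /path_pow -!val_eqE /=; lia.
have -> : ord_itv a b :\ x = ord_itv a b.-1.
  by apply/setP => y; rewrite !inE -!val_eqE /=; lia.
rewrite !IHb; try lia.
rewrite [RHS]hfib_step; last lia.
congr (_ + _); first by congr hfib; lia.
(* In a short interval the last vertex excludes all others; truncation then makes the indices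
   differ, but both lie between 1 and [h.+1]. *)
have [lehb|ltbh] := leqP (b - a) h; last by congr hfib; lia.
by rewrite !hfib_small; lia.
Qed.

Lemma card_indep_mem_path_pow (x : 'I_n) :
  #|[set S in indep_in e setT | x \in S]| = hfib h x.+1 * hfib h (n - x).
Proof.
have ltxn := ltn_ord x.
rewrite (card_indep_in_mem path_pow_sym path_pow_irr) ?inE //.
(* Removing [x] and its neighbours leaves two intervals, either possibly empty, with no edge
   across. *)
have -> : [set y in setT :\ x | ~~ e x y]
    = ord_itv 0 (x - h) :|: ord_itv (x + h.+1) n.
  apply/setP => y; have := ltn_ord y.
  by rewrite !inE /e /path_pow -!val_eqE /=; lia.
rewrite card_indep_inU; first last.
- by move=> y z; rewrite !inE /e /path_pow -!val_eqE /=; lia.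
- by rewrite -setI_eq0; apply/eqP/setP => y; rewrite !inE; lia.
rewrite !card_indep_in_itv; try lia.
congr (_ * _).
  (* When [x] is within [h] of the left end, that side is empty and both indices fall in the initial
     run of ones; likewise on the right below. *)
  have [lexh|lthx] := leqP x h; last by congr hfib; lia.
  by rewrite !hfib_small; lia.
have [lexh|lthx] := leqP (n - x) h; last by congr hfib; lia.
by rewrite !hfib_small; lia.
Qed.

End PathPower.

Theorem theorem3p1 (n h : nat) :
  hasse_path_pow h n
  = (\sum_(1 <= i < n.+1) hfib h i * hfib h (n - i + 1))%N.
Proof.
(* Ordinals start at 0, so [x] stands for the summation index [i = x.+1]. *)
rewrite /hasse_path_pow card_hasse_edges_indep big_add1 big_mkord /=.
apply: eq_bigr => x _; rewrite card_indep_mem_path_pow.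
by congr (_ * hfib h _); have := ltn_ord x; lia.
Qed.
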